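(* For a finite set $Z$, a row-stochastic kernel $P$ on $Z$, an integer $\tau\ge1$, a map $f:Z\to X$ to a finite set, and prototype distributions $(u_x)_{x\in X}$ with $\mathrm{supp}(u_x)\subseteq f^{-1}(x)$, call $u_x$ $\varepsilon$-stable if $\|E_{\tau,f}(u_x)-u_x\|_{\mathrm{TV}}\le\varepsilon$, where $E_{\tau,f}(\mu)=U_f(Q_f(\mu P^\tau))$, $(Q_f\mu)(x)=\sum_{z\in f^{-1}(x)}\mu(z)$ and $(U_f\nu)(z)=\sum_x\nu(x)u_x(z)$. Then both of the following occur: (1) there exist $Z,P,\tau$, two lenses $f_{\mathrm{fine}}:Z\to X_{\mathrm{fine}}$ and $f_{\mathrm{coarse}}:Z\to X_{\mathrm{coarse}}$ with $f_{\mathrm{coarse}}=g\circ f_{\mathrm{fine}}$ for some map $g$ (so the fine partition refines the coarse one), prototype families for each lens, and a threshold $\varepsilon>0$ such that the number of $\varepsilon$-stable prototypes for $f_{\mathrm{fine}}$ is strictly larger than for $f_{\mathrm{coarse}}$; (2) there exist such data for which the number of $\varepsilon$-stable prototypes for $f_{\mathrm{fine}}$ is strictly smaller than for $f_{\mathrm{coarse}}$.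
   Context: $\Delta(Z)$ is the simplex of probability distributions on $Z$ (row vectors), and $\|\mu-\nu\|_{\mathrm{TV}}=\tfrac12\|\mu-\nu\|_1$. *)

(* Defs.v *)
From mathcomp Require Import all_boot all_order all_algebra.
From mathcomp Require Import reals.
Set Implicit Arguments.
Unset Strict Implicit.
Unset Printing Implicit Defensive.
Import Order.TTheory GRing.Theory Num.Theory.
Local Open Scope ring_scope.

(* Functions on a finite set Z are row vectors of length #|Z|, the coordinates
   being numbered by the bijection enum_rank : Z -> 'I_#|Z|, of inverse
   enum_val; a kernel on Z is a square matrix of size #|Z| with the same
   numbering. *)

Definition value_at (R : realType) (Z : finType) (mu : 'rV[R]_#|Z|) (z : Z) : R :=
  mu 0 (enum_rank z).

Definition distribution (R : realType) (n : nat) (mu : 'rV[R]_n) : Prop :=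
  (forall i, 0 <= mu 0 i) /\ \sum_(i < n) mu 0 i = 1.

Definition row_stochastic (R : realType) (n : nat) (P : 'M[R]_n) : Prop :=
  forall i, distribution (row i P).

Definition tv_dist (R : realType) (n : nat) (mu nu : 'rV[R]_n) : R :=
  2^-1 * \sum_(i < n) `|mu 0 i - nu 0 i|.

Definition prototypes (R : realType) (Z X : finType) (f : Z -> X)
    (u : X -> 'rV[R]_#|Z|) : Prop :=
  forall x, distribution (u x) /\ (forall z, value_at (u x) z != 0 -> f z = x).

Definition coarsen (R : realType) (Z X : finType) (f : Z -> X)
    (mu : 'rV[R]_#|Z|) : 'rV[R]_#|X| :=
  \row_(i < #|X|) \sum_(z | f z == enum_val i) value_at mu z.

Definition lift_proto (R : realType) (Z X : finType) (u : X -> 'rV[R]_#|Z|)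
    (nu : 'rV[R]_#|X|) : 'rV[R]_#|Z| :=
  \sum_(x : X) value_at nu x *: u x.

Definition evolve (R : realType) (Z X : finType) (P : 'M[R]_#|Z|) (tau : nat)
    (f : Z -> X) (u : X -> 'rV[R]_#|Z|) (mu : 'rV[R]_#|Z|) : 'rV[R]_#|Z| :=
  lift_proto u (coarsen f (mu *m P ^+ tau)).

Definition stable (R : realType) (Z X : finType) (P : 'M[R]_#|Z|) (tau : nat)
    (f : Z -> X) (u : X -> 'rV[R]_#|Z|) (eps : R) (x : X) : bool :=
  tv_dist (evolve P tau f u (u x)) (u x) <= eps.

(* Counting indices x is the same as counting the distributions u x: the
   latter are pairwise distinct, being nonzero with disjoint supports. *)
Definition num_stable (R : realType) (Z X : finType) (P : 'M[R]_#|Z|)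
    (tau : nat) (f : Z -> X) (u : X -> 'rV[R]_#|Z|) (eps : R) : nat :=
  #|[set x : X | stable P tau f u eps x]|.

(* Main.v *)
Require Import Defs.
From mathcomp Require Import all_boot all_order all_algebra.
From mathcomp Require Import reals.
Import Order.TTheory GRing.Theory Num.Theory.
Local Open Scope ring_scope.

(** For the one-point lens every distribution is sent to the unique prototype,
    so exactly one prototype is stable, whatever the kernel is.  For the
    identity lens with Dirac prototypes, the kernel of a deterministic map
    [phi] sends the prototype at [z] to the one at [phi z], at distance [1]
    unless [phi z = z], so the stable prototypes are the fixed points of [phi].
    On a two-point set the identity has two fixed points and the swap none. *)

Section Dirac.
Context {R : realType} {Z : finType}.
Implicit Types (y z : Z) (mu : 'rV[R]_#|Z|) (phi : Z -> Z).

Definition dirac z : 'rV[R]_#|Z| := delta_mx 0 (enum_rank z).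

Definition map_kernel phi : 'M[R]_#|Z| :=
  \matrix_(i < #|Z|) dirac (phi (enum_val i)).

Lemma diracE z i : dirac z 0 i = (i == enum_rank z)%:R.
Proof. by rewrite mxE eqxx. Qed.

Lemma value_at_dirac y z : value_at (dirac y) z = (z == y)%:R.
Proof. by rewrite /value_at diracE (inj_eq enum_rank_inj). Qed.

Lemma distribution_dirac z : distribution (dirac z).
Proof.
split=> [i|]; first by rewrite diracE ler0n.
rewrite (bigD1 (enum_rank z)) //= diracE eqxx big1 ?addr0 // => i.
by rewrite diracE => /negPf ->.
Qed.

Lemma row_stochastic_map_kernel phi : row_stochastic (map_kernel phi).
Proof. by move=> i; rewrite rowK; apply: distribution_dirac. Qed.

Lemma dirac_map_kernel phi z : dirac z *m map_kernel phi = dirac (phi z).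
Proof. by rewrite -rowE rowK enum_rankK. Qed.

(** Bridges sums over points, as in [coarsen], and sums over coordinates, as in [distribution];
    [enum_rank] is the bijection used to reindex. *)
Lemma sum_value_at mu : \sum_z value_at mu z = \sum_i mu 0 i.
Proof.
rewrite [RHS](reindex (@enum_rank Z)) //.
by exists enum_val => ? _; rewrite ?enum_rankK ?enum_valK.
Qed.

Lemma tv_distxx (n : nat) (nu : 'rV[R]_n) : tv_dist nu nu = 0.
Proof.
by rewrite /tv_dist big1 ?mulr0 // => i _; rewrite subrr normr0.
Qed.

(** For distinct points only the coordinates of [y] and [z] contribute, each by 1, and the factor
    one half normalizes the sum to 1. *)
Lemma tv_dist_dirac y z : tv_dist (dirac y) (dirac z) = (y != z)%:R.
Proof.
have [->|neq_yz] := eqVneq y z; first exact: tv_distxx.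
have neq_rank : enum_rank z != enum_rank y.
  by rewrite (inj_eq enum_rank_inj) eq_sym.
rewrite /tv_dist (bigD1 (enum_rank y)) //= (bigD1 (enum_rank z)) //=.
rewrite big1 => [|i /andP[/negPf iy /negPf iz]]; last first.
  by rewrite !diracE iy iz subrr normr0.
rewrite !diracE !eqxx (negPf neq_rank) eq_sym (negPf neq_rank).
by rewrite subr0 sub0r normrN normr1 addr0 mulVf ?pnatr_eq0.
Qed.

Lemma prototypes_dirac : prototypes id dirac.
Proof.
move=> x; split=> [|z]; first exact: distribution_dirac.
by rewrite value_at_dirac pnatr_eq0 eqb0 negbK => /eqP.
Qed.

(** The fibres of the identity are singletons, so coarsening loses nothing, and lifting with Dirac
    prototypes expands a vector in the standard basis: together they act as the identity. *)
Lemma evolve_dirac (P : 'M[R]_#|Z|) (tau : nat) mu :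
  evolve P tau id dirac mu = mu *m P ^+ tau.
Proof.
apply/rowP => i; rewrite /evolve /lift_proto summxE.
rewrite (bigD1 (enum_val i)) //= big1 => [|z /negPf neq_zi]; last first.
  by rewrite !mxE eqxx -(enum_valK i) (inj_eq enum_rank_inj) eq_sym neq_zi mulr0.
rewrite addr0 mxE diracE enum_valK eqxx mulr1 /value_at mxE enum_rankK.
by rewrite big_pred1_eq /value_at enum_valK.
Qed.

(** The distance from a prototype to its image is 0 or 1, and a threshold in [0, 1) accepts exactly
    the value 0. *)
Lemma num_stable_dirac phi (eps : R) : 0 <= eps < 1 ->
  num_stable (map_kernel phi) 1 id dirac eps = #|[set z | phi z == z]|.
Proof.
move=> /andP[eps_ge0 eps_lt1]; apply: eq_card => z; rewrite !inE /stable.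
rewrite evolve_dirac expr1 dirac_map_kernel tv_dist_dirac.
by case: eqVneq; rewrite ?eps_ge0 // leNgt eps_lt1.
Qed.

End Dirac.

Section OnePointLens.
Context {R : realType} {Z : finType}.
Implicit Types (P : 'M[R]_#|Z|) (mu : 'rV[R]_#|Z|) (u : unit -> 'rV[R]_#|Z|).

Lemma prototypes_one_point u :
  distribution (u tt) -> prototypes (fun _ : Z => tt) u.
Proof. by move=> du []. Qed.

(** After exchanging the two sums, each coordinate of [nu] is multiplied by a row sum of [P], which
    is 1. *)
Lemma row_stochastic_mass (n : nat) (nu : 'rV[R]_n) (P : 'M[R]_n) :
  row_stochastic P -> \sum_j (nu *m P) 0 j = \sum_i nu 0 i.
Proof.
move=> stoP; under eq_bigr do rewrite mxE.
rewrite exchange_big; apply: eq_bigr => i _ /=.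
rewrite -mulr_sumr -[RHS]mulr1; congr (_ * _).
by rewrite -(stoP i).2; apply: eq_bigr => j _; rewrite mxE.
Qed.

Lemma row_stochastic_exp_mass (n : nat) (nu : 'rV[R]_n) (P : 'M[R]_n)
    (tau : nat) :
  row_stochastic P -> \sum_j (nu *m P ^+ tau) 0 j = \sum_i nu 0 i.
Proof.
move=> stoP; elim: tau => [|tau IH]; first by rewrite expr0 mulmx1.
by rewrite exprSr mulmxA row_stochastic_mass.
Qed.

(** The coarsened vector has a single coordinate, the total mass of [mu *m P ^+ tau]. The kernel
    preserves mass, so [u tt] is scaled by 1. *)
Lemma evolve_one_point P (tau : nat) u mu :
  row_stochastic P -> distribution mu ->
  evolve P tau (fun=> tt) u mu = u tt.
Proof.
move=> stoP [_ mass1]; rewrite /evolve /lift_proto (big_pred1 tt) => [|[]//].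
rewrite /value_at mxE (eq_bigl xpredT) => [|z]; last by case: (enum_val _).
by rewrite sum_value_at row_stochastic_exp_mass // mass1 scale1r.
Qed.

Lemma num_stable_one_point P (tau : nat) u (eps : R) :
  row_stochastic P -> distribution (u tt) -> 0 <= eps ->
  num_stable P tau (fun=> tt) u eps = 1%N.
Proof.
move=> stoP du eps_ge0; rewrite -card_unit; apply: eq_card => -[].
by rewrite inE /stable evolve_one_point // tv_distxx.
Qed.

End OnePointLens.

Theorem mainTheorem2 (R : realType) :
  (exists (Z : finType) (P : 'M[R]_#|Z|) (tau : nat)
          (Xfine Xcoarse : finType)
          (ffine : Z -> Xfine) (fcoarse : Z -> Xcoarse) (g : Xfine -> Xcoarse)
          (ufine : Xfine -> 'rV[R]_#|Z|) (ucoarse : Xcoarse -> 'rV[R]_#|Z|)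
          (eps : R),
      row_stochastic P /\ (1 <= tau)%N /\
      (forall z, fcoarse z = g (ffine z)) /\
      prototypes ffine ufine /\ prototypes fcoarse ucoarse /\
      0 < eps /\
      (num_stable P tau fcoarse ucoarse eps
         < num_stable P tau ffine ufine eps)%N)
  /\
  (exists (Z : finType) (P : 'M[R]_#|Z|) (tau : nat)
          (Xfine Xcoarse : finType)
          (ffine : Z -> Xfine) (fcoarse : Z -> Xcoarse) (g : Xfine -> Xcoarse)
          (ufine : Xfine -> 'rV[R]_#|Z|) (ucoarse : Xcoarse -> 'rV[R]_#|Z|)
          (eps : R),
      row_stochastic P /\ (1 <= tau)%N /\
      (forall z, fcoarse z = g (ffine z)) /\
      prototypes ffine ufine /\ prototypes fcoarse ucoarse /\
      0 < eps /\
      (num_stable P tau ffine ufine eps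
         < num_stable P tau fcoarse ucoarse eps)%N).
Proof.
(* The threshold is one half in both examples; any value strictly between 0 and 1 would do. *)
have half_gt0 : 0 < 2^-1 :> R by rewrite invr_gt0 ltr0n.
have half01 : 0 <= (2^-1 : R) < 1 by rewrite ltW // invf_lt1 ?ltr0n // ltr1n.
have sto (phi : bool -> bool) : row_stochastic (@map_kernel R bool phi).
  exact: row_stochastic_map_kernel.
have fine : prototypes id (@dirac R bool).
  exact: prototypes_dirac.
have du : distribution (@dirac R bool true).
  exact: distribution_dirac.
have coarse := prototypes_one_point (fun=> dirac true) du.
split.
(* Identity dynamics: both fine prototypes are stable, against one coarse prototype. *)
- exists bool, (map_kernel id), 1%N, bool, unit, id, (fun=> tt), (fun=> tt).
  exists dirac, (fun=> dirac true), 2^-1.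
  do 6![split; first by []].
  rewrite num_stable_one_point ?ltW // num_stable_dirac //.
  rewrite (_ : [set z | _] = setT) ?cardsT ?card_bool //.
  by apply/setP => z; rewrite !inE eqxx.
(* Swap dynamics: [negb] has no fixed point, so no fine prototype is stable, while the coarse one
   still is. *)
- exists bool, (map_kernel negb), 1%N, bool, unit, id, (fun=> tt), (fun=> tt).
  exists dirac, (fun=> dirac true), 2^-1.
  do 6![split; first by []].
  rewrite num_stable_one_point ?ltW // num_stable_dirac //.
  rewrite (_ : [set z | _] = set0) ?cards0 //.
  by apply/setP => -[]; rewrite !inE.
Qed.
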